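(* Let $R$ be a bleached local ring. The following are equivalent: (1) $R$ is uniquely bleached. (2) $\mathcal{T}_3(R)$ is quasipolar. (3) $T_2(R)$ is quasipolar.
   Context: All rings are associative with identity, not necessarily commutative; $U(R)$ and $J(R)$ denote the group of units and the Jacobson radical of $R$. A ring $R$ is local if $R/J(R)$ is a division ring. For $a$ in a ring $R$: $comm(a)=\{x\in R: xa=ax\}$, $comm^2(a)=\{x\in R: xy=yx \text{ for all } y\in comm(a)\}$, and $R^{qnil}=\{a\in R: 1+ax\in U(R)\text{ for every }x\in comm(a)\}$. An element $a\in R$ is quasipolar if there is an idempotent $p=p^2\in R$ with $p\in comm^2(a)$, $a+p\in U(R)$ and $ap\in R^{qnil}$. A ring is quasipolar if each of its elements is quasipolar. For $a\in R$ let $l_a,r_a:R\to R$ be the additive group endomorphisms $l_a(r)=ar$, $r_a(r)=ra$; thus $(l_a-r_b)(r)=ar-rb$. A local ring $R$ is bleached if for all $a\in J(R)$ and $b\in U(R)$ the maps $l_b-r_a$ and $l_a-r_b$ are both surjective. It is uniquely bleached if for all $a\in J(R)$ and $b\in U(R)$ the maps $l_b-r_a$ and $l_a-r_b$ are both isomorphisms of the additive group of $R$. $T_2(R)$ is the ring of $2\times 2$ upper triangular matrices over $R$, and $\mathcal{T}_3(R)$ is the subring of $M_3(R)$ consisting of all matrices $\begin{bmatrix} a_{11}&0&0\\ a_{21}&a_{22}&a_{23}\\ 0&0&a_{33}\end{bmatrix}$ with $a_{11},a_{21},a_{22},a_{23},a_{33}\in R$. *)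

(* Defs.v *)
From HB Require Import structures.
From mathcomp Require Import all_boot all_order all_algebra.

Set Implicit Arguments.
Unset Strict Implicit.
Unset Printing Implicit Defensive.

Import GRing.Theory.
Local Open Scope ring_scope.

(* [pzRingType] is the class of associative rings with identity; neither
   commutativity nor [1 != 0] is assumed. Units and ideals are Prop-valued, as
   they need not be decidable in such a ring. *)

Section RingNotions.
Variable R : pzRingType.
Implicit Types (a b p x y : R) (I K : R -> Prop).

Definition is_unit a : Prop := exists b, a * b = 1 /\ b * a = 1.

Definition left_ideal I : Prop :=
  [/\ I 0, forall x y, I x -> I y -> I (x + y) & forall r x, I x -> I (r * x)].

Definition maximal_left_ideal I : Prop :=
  [/\ left_ideal I, ~ I 1 &
      forall K, left_ideal K -> ~ K 1 -> (forall x, I x -> K x) ->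
        forall x, K x -> I x].

Definition jacobson x : Prop := forall I, maximal_left_ideal I -> I x.

(* "R / J(R) is a division ring", written on representatives: the class of 1
   is nonzero, and every nonzero class has a two-sided inverse. *)
Definition local_ring : Prop :=
  ~ jacobson 1 /\
  forall x, ~ jacobson x ->
    exists y, jacobson (x * y - 1) /\ jacobson (y * x - 1).

Definition comm a x : Prop := x * a = a * x.

Definition comm2 a x : Prop := forall y, comm a y -> x * y = y * x.

Definition qnil a : Prop := forall x, comm a x -> is_unit (1 + a * x).

Definition quasipolar_elt a : Prop :=
  exists p, [/\ p * p = p, comm2 a p, is_unit (a + p) & qnil (a * p)].

Definition quasipolar : Prop := forall a, quasipolar_elt a.

(* l_a - r_b *)
Definition lr_sub a b : R -> R := *%R a \- *%R^~ b.

Lemma lr_sub_is_zmod_morphism a b : zmod_morphism (lr_sub a b).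
Proof.
move=> x y; rewrite /lr_sub /= mulrBr mulrBl !opprB addrACA [RHS]addrACA.
by rewrite [- (a * y) - _]addrC.
Qed.

HB.instance Definition _ a b :=
  GRing.isZmodMorphism.Build R R (lr_sub a b) (lr_sub_is_zmod_morphism a b).

Definition surjective (f : R -> R) : Prop := forall y, exists x, f x = y.

Definition bleached : Prop :=
  forall a b, jacobson a -> is_unit b ->
    surjective (lr_sub b a) /\ surjective (lr_sub a b).

(* [lr_sub] is additive, so it is an isomorphism of the additive group of R as
   soon as it is bijective. *)
Definition uniquely_bleached : Prop :=
  forall a b, jacobson a -> is_unit b ->
    bijective (lr_sub b a) /\ bijective (lr_sub a b).

End RingNotions.

Section MatrixRings.
Variable R : pzRingType.

(* [is_trig_mx] is lower triangularity *)
Definition T2_pred : {pred 'M[R]_2} := [pred A | is_trig_mx A^T].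

(* rows and columns are numbered 0, 1, 2: only the diagonal and the entries
   (1, 0) and (1, 2) may be nonzero *)
Definition T3_pred : {pred 'M[R]_3} :=
  [pred A : 'M[R]_3 | [forall i, forall j, (i != j) && (i != 1) ==> (A i j == 0)]].

Lemma T3_predP (A : 'M[R]_3) :
  reflect (forall i j, i != j -> i != 1 -> A i j = 0) (A \in T3_pred).
Proof.
apply: (iffP forallP) => [h i j nij ni1|h i].
  by have /forallP/(_ j) := h i; rewrite nij ni1 => /eqP.
by apply/forallP => j; apply/implyP => /andP[nij ni1]; rewrite h.
Qed.

Lemma T2_predP (A : 'M[R]_2) :
  reflect (forall i j : 'I_2, (j < i)%N -> A i j = 0) (A \in T2_pred).
Proof.
by apply: (iffP is_trig_mxP) => h i j /h; rewrite ?mxE.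
Qed.

Lemma T2_subring_closed : subring_closed T2_pred.
Proof.
split=> [|A B /T2_predP hA /T2_predP hB|A B /T2_predP hA /T2_predP hB].
- by apply/T2_predP => i j ji; rewrite mxE -val_eqE gtn_eqF.
- by apply/T2_predP => i j ji; rewrite !mxE hA ?hB ?subr0.
apply/T2_predP => i j ji; rewrite mxE big1 // => k _.
have [ki|ik] := ltnP k i; first by rewrite hA ?mul0r.
by rewrite [B k j]hB ?mulr0 // (leq_trans ji ik).
Qed.

Lemma T3_subring_closed : subring_closed T3_pred.
Proof.
split=> [|A B /T3_predP hA /T3_predP hB|A B /T3_predP hA /T3_predP hB].
- by apply/T3_predP => i j /negPf nij _; rewrite mxE nij.
- by apply/T3_predP => i j nij ni1; rewrite !mxE hA ?hB ?subr0.
apply/T3_predP => i j nij ni1; rewrite mxE big1 // => k _.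
have [<-|nik] := eqVneq i k; first by rewrite [B i j]hB ?mulr0.
by rewrite hA ?mul0r.
Qed.

HB.instance Definition _ :=
  GRing.isSubringClosed.Build 'M[R]_2 T2_pred T2_subring_closed.
HB.instance Definition _ :=
  GRing.isSubringClosed.Build 'M[R]_3 T3_pred T3_subring_closed.

Record T2 := MkT2 { T2_val :> 'M[R]_2; T2_valP : T2_val \in T2_pred }.
HB.instance Definition _ := [isSub of T2 for T2_val].
HB.instance Definition _ := [Choice of T2 by <:].
HB.instance Definition _ := GRing.SubChoice_isSubPzRing.Build 'M[R]_2 T2_pred T2
  (GRing.subringClosedP _).

Record T3 := MkT3 { T3_val :> 'M[R]_3; T3_valP : T3_val \in T3_pred }.
HB.instance Definition _ := [isSub of T3 for T3_val].
HB.instance Definition _ := [Choice of T3 by <:].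
HB.instance Definition _ := GRing.SubChoice_isSubPzRing.Build 'M[R]_3 T3_pred T3
  (GRing.subringClosedP _).

End MatrixRings.

(* Main.v *)
(** Let [A] be in T_2(R) or T_3(R) with [R] local.  Each diagonal entry of [A]
    is a unit (idempotent 0) or lies in J(R) (idempotent 1), so the
    diagonal of the spectral idempotent [p] of [A] is forced.  The
    off-diagonal entries of [p] solve Sylvester equations [c q - q a = k b], in
    which one of [a], [c] is a unit and the other lies in J(R) unless [k = 0];
    bleachedness solves them, and injectivity of [l_c - r_a] makes the
    resulting [p] commute with the whole commutant of [A].  Conversely, if
    [c x = x d], then the matrix unit multiple [x E_01] commutes with
    [diag(c, d)], hence with its spectral idempotent [diag(1, 0)] or
    [diag(0, 1)], which forces [x = 0].  Finally T_2(R) is a corner of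
    T_3(R). *)
Require Import Defs.
From HB Require Import structures.
From mathcomp Require Import all_boot all_order all_algebra.
From mathcomp Require Import boolp classical_sets.

Set Implicit Arguments.
Unset Strict Implicit.
Unset Printing Implicit Defensive.

Import GRing.Theory.
Local Open Scope ring_scope.

(** * Units of noncommutative rings *)

Section Units.
Variable R : pzRingType.
Implicit Types a b u v x y : R.

Lemma is_unit1 : is_unit (1 : R).
Proof. by exists 1; rewrite mulr1. Qed.

Lemma is_unit_linv_rinv u v x : u * x = 1 -> x * v = 1 -> is_unit x.
Proof.
move=> ux xv; exists v; split=> //.
by rewrite -[v]mul1r -ux -(mulrA u) xv mulr1.
Qed.

(** Jacobson's lemma: if [u] inverts [1 + b a], then [1 - a u b] inverts [1 + a b]. *)
Lemma is_unit_1addMC a b : is_unit (1 + b * a) -> is_unit (1 + a * b).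
Proof.
case=> u [bau uba]; exists (1 - a * u * b); split.
  rewrite mulrBr mulr1.
  have -> : (1 + a * b) * (a * u * b) = a * ((1 + b * a) * u) * b.
    by rewrite !mulrDl !mul1r mulrDr mulrDl !mulrA.
  by rewrite bau mulr1 addrK.
rewrite mulrBl mul1r.
have -> : a * u * b * (1 + a * b) = a * (u * (1 + b * a)) * b.
  by rewrite !mulrDr !mulr1 mulrDl !mulrA.
by rewrite uba mulr1 addrK.
Qed.

End Units.

Lemma is_unit_rmorph (S T : pzRingType) (f : {rmorphism S -> T}) x :
  is_unit x -> is_unit (f x).
Proof. by case=> y [xy yx]; exists (f y); rewrite -!rmorphM xy yx rmorph1. Qed.

(** * Maximal left ideals from Zorn's lemma *)

Section MaximalLeftIdeals.
Variable R : pzRingType.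
Local Open Scope classical_set_scope.

Lemma exists_maximal_left_ideal (I : R -> Prop) :
  left_ideal I -> ~ I 1 ->
  exists2 M, maximal_left_ideal M & forall x, I x -> M x.
Proof.
move=> lI I1.
(* Joining [I] to the candidates makes the empty chain harmless. *)
pose P := [set X : set R | left_ideal (X `|` I) /\ ~ (X `|` I) 1].
have [F FP Ftot|A [[lA A1] Amax]] := @Zorn_bigcup R P.
  have sub X : F X -> X `|` I `<=` \bigcup_(X in F) X `|` I.
    by move=> FX x [Xx|]; [left; exists X|right].
  split; last by case=> // -[X FX X1]; case: (FP X FX) => _ []; left.
  split.
  - by right; case: lI.
  - move=> x y [[X FX Xx]|Ix] [[Y FY Yy]|Iy].
    + have [XY|YX] := Ftot X Y FX FY.
        apply: (sub Y FY); case: (FP Y FY) => -[_ + _ _].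
        by apply; left=> //; apply: XY.
      apply: (sub X FX); case: (FP X FX) => -[_ + _ _].
      by apply; left=> //; apply: YX.
    + apply: (sub X FX); case: (FP X FX) => -[_ + _ _].
      by apply; [left|right].
    + apply: (sub Y FY); case: (FP Y FY) => -[_ + _ _].
      by apply; [right|left].
    + by right; case: lI => _ + _; apply.
  - move=> r x [[X FX Xx]|Ix].
      by apply: (sub X FX); case: (FP X FX) => -[_ _ + _]; apply; left.
    by right; case: lI => _ _; apply.
exists (A `|` I); last by right.
split=> // K lK K1 AK x Kx.
(* Hence [K] itself satisfies [P], and the maximality of [A] can be tested against it. *)
have KI : K `|` I = K by apply/setUidl => y Iy; apply: AK; right.
apply: contrapT => nAx; apply: (Amax K); last by split; rewrite KI.
split=> [y Ay|KA]; first by apply: AK; left.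
by apply: nAx; left; apply: KA.
Qed.

End MaximalLeftIdeals.

(** * The Jacobson radical and local rings *)

Section Jacobson.
Variable R : pzRingType.
Implicit Types a b p r x y : R.

Lemma jacobsonM r x : jacobson x -> jacobson (r * x).
Proof. by move=> Jx I mI; case: (mI) => -[_ _ + _] _; apply; apply: Jx. Qed.

Lemma jacobsonN x : jacobson x -> jacobson (- x).
Proof. by rewrite -mulN1r; apply: jacobsonM. Qed.

(** Otherwise [R (1 + x)] is a proper left ideal; a maximal left ideal above it also contains [x],
    hence 1. *)
Lemma jacobson_add1_linv x : jacobson x -> exists u, u * (1 + x) = 1.
Proof.
move=> Jx; apply: contrapT => nu.
pose I y := exists r, y = r * (1 + x).
have lI : left_ideal I.
  split=> [|_ _ [r ->] [s ->]|r _ [s ->]]; first by exists 0; rewrite mul0r.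
    by exists (r + s); rewrite mulrDl.
  by exists (r * s); rewrite mulrA.
have I1 : ~ I 1 by case=> u u1; apply: nu; exists u.
have [M mM IM] := exists_maximal_left_ideal lI I1.
have := mM; case=> -[_ MD MM] M1 _; apply: M1.
rewrite -(addrK x 1); apply: MD; first by apply: IM; exists 1; rewrite mul1r.
by rewrite -mulN1r; apply: MM; apply: Jx.
Qed.

(** The left inverse [u] equals [1 - u x], so it has a left inverse as well, which must be
    [1 + x]. *)
Lemma is_unit_1addJ x : jacobson x -> is_unit (1 + x).
Proof.
move=> Jx; have [u ux] := jacobson_add1_linv Jx.
have uE : u = 1 + - u * x.
  by apply/eqP; rewrite mulNr eq_sym subr_eq -ux mulrDr mulr1.
have [v] := jacobson_add1_linv (jacobsonM (- u) Jx); rewrite -uE => vu.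
have vE : v = 1 + x by rewrite -[v]mulr1 -[X in v * X]ux mulrA vu mul1r.
by exists u; rewrite -{1}vE.
Qed.

(** [jacobsonM] absorbs factors on the left only, so the product is first flipped to [x a]. *)
Lemma is_unit_1addJM a x : jacobson a -> is_unit (1 + a * x).
Proof.
by move=> Ja; apply: is_unit_1addMC; apply: is_unit_1addJ; apply: jacobsonM.
Qed.

Hypothesis Rlocal : local_ring R.

Lemma local_jacobson_not_unit a : jacobson a -> ~ is_unit a.
Proof.
move=> Ja [b [_ ba]]; case: Rlocal => + _; apply.
by rewrite -ba; apply: jacobsonM.
Qed.

Lemma local_not0_unit : ~ is_unit (0 : R).
Proof.
by apply: local_jacobson_not_unit => I [[]].
Qed.

Lemma local_unit_or_jacobson a : is_unit a \/ jacobson a.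
Proof.
have [|nJa] := pselect (jacobson a); [by right|left].
have [_ /(_ a nJa)[y []]] := Rlocal.
(* Both [a y] and [y a] lie in 1 + J(R), so they are units; their inverses give a right and a left
   inverse of [a]. *)
move=> /is_unit_1addJ; rewrite addrC subrK => -[u [ayu _]].
move=> /is_unit_1addJ; rewrite addrC subrK => -[v [_ vya]].
apply: (is_unit_linv_rinv (u := v * y) (v := y * u)).
  by rewrite -mulrA.
by rewrite mulrA.
Qed.

(** A unit idempotent is 1, and one in J(R) is killed by the unit [1 - p]. *)
Lemma local_idempotent p : p * p = p -> p = 0 \/ p = 1.
Proof.
move=> pp; have [[q [pq qp]]|Jp] := local_unit_or_jacobson p.
  by right; rewrite -[p]mul1r -qp -mulrA pp.
left; have [q [_ qp]] := is_unit_1addJ (jacobsonN Jp).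
by rewrite -[p]mul1r -qp -mulrA mulrBl mul1r pp subrr mulr0.
Qed.

End Jacobson.

(** * Spectral idempotents and Sylvester equations *)

Section SpectralIdempotents.
Variable R : pzRingType.
Implicit Types a b c e p q u v x y : R.

(* For [R] local, [e] is the spectral idempotent of [a]. *)
Definition local_spectral a e :=
  (e = 0 /\ is_unit a) \/ (e = 1 /\ jacobson a).

Lemma local_spectral_exists (Rlocal : local_ring R) a :
  exists e, local_spectral a e.
Proof.
have [?|?] := local_unit_or_jacobson Rlocal a.
  by exists 0; left.
by exists 1; right.
Qed.

Lemma local_spectral_uniq (Rlocal : local_ring R) a e p :
  local_spectral a e -> p * p = p -> is_unit (a + p) -> qnil (a * p) -> p = e.
Proof.
move=> ae /(local_idempotent Rlocal)[]-> => [|_ a_qnil].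
  by rewrite addr0 => a_unit _; case: ae => -[-> // /local_jacobson_not_unit[]].
case: ae => -[-> // [b [ab ba]]].
have [] := local_not0_unit Rlocal.
(* With [p = 1] and [a] a unit, the element [- a^-1] contradicts quasinilpotence. *)
have -> : 0 = 1 + a * 1 * - b :> R by rewrite mulr1 mulrN ab subrr.
by apply: a_qnil; rewrite /comm mulr1 mulNr mulrN ab ba.
Qed.

Lemma lr_subE a b x : lr_sub a b x = a * x - x * b.
Proof. by []. Qed.

(** The last three hypotheses say that [[v, y], [0, u]] commutes with [[c, b], [0, a]]. The map
    [lr_sub c a] sends the left side of the conclusion to [k (b u - v b + c y - y a)], which is
    0. *)
Lemma sylvester_commutant a b c q u v y k :
    injective (lr_sub c a) -> (forall z, GRing.comm k z) ->
    lr_sub c a q = k * b -> u * a = a * u -> v * c = c * v ->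
    y * a + v * b = b * u + c * y ->
  q * u - v * q + k * y = 0.
Proof.
move=> inj_ca kC; rewrite lr_subE => qE ua vc ycomm.
apply: inj_ca; rewrite raddf0 raddfD raddfB /=.
have -> : lr_sub c a (q * u) = k * (b * u).
  by rewrite lr_subE -mulrA ua !mulrA -mulrBl qE.
have -> : lr_sub c a (v * q) = k * (v * b).
  by rewrite lr_subE mulrA -vc -!mulrA -mulrBr qE mulrA -(kC v) mulrA.
have -> : lr_sub c a (k * y) = k * (c * y - y * a).
  by rewrite lr_subE mulrA -kC mulrBr !mulrA.
rewrite -mulrBr -mulrDr addrACA -ycomm -opprD [v * b + _]addrC subrr.
by rewrite mulr0.
Qed.

(** The properties of [q] are the off-diagonal entries of P P = P and P Y = Y P, where P = [[e, q],
    [0, e']] and Y = [[v, y], [0, u]]. The equation to solve is [c q - q a = k b] with [k = e - e'],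
    so [q = 0] serves when [e = e']. *)
Lemma sylvester_spectral (Rbl : uniquely_bleached R) a b c e e' :
    local_spectral c e -> local_spectral a e' ->
  exists q, e * q + q * e' = q /\
    forall u v y, u * a = a * u -> v * c = c * v ->
      y * a + v * b = b * u + c * y -> e * y + q * u = v * q + y * e'.
Proof.
have bij_surj f : bijective f -> @surjective R f.
  by case=> g fK gK z; exists (g z).
case=> -[-> hc] [] [-> ha].
- exists 0; split=> [|u v y _ _ _]; first by rewrite !(mulr0, mul0r) addr0.
  by rewrite !(mulr0, mul0r).
- have [/[dup] /bij_inj inj_ca /bij_surj surj_ca _] := Rbl _ _ ha hc.
  have [q qE] := surj_ca (-1 * b).
  exists q; split=> [|u v y ua vc ycomm]; first by rewrite mul0r mulr1 add0r.
  have kC (z : R) : GRing.comm (-1) z by rewrite /GRing.comm mulN1r mulrN1.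
  have /eqP := sylvester_commutant inj_ca kC qE ua vc ycomm.
  by rewrite mulN1r subr_eq0 subr_eq => /eqP->; rewrite mul0r add0r mulr1 addrC.
- have [_ /[dup] /bij_inj inj_ca /bij_surj surj_ca] := Rbl _ _ hc ha.
  have [q qE] := surj_ca (1 * b).
  exists q; split=> [|u v y ua vc ycomm]; first by rewrite mulr0 mul1r addr0.
  have kC (z : R) : GRing.comm 1 z by rewrite /GRing.comm mul1r mulr1.
  have /eqP := sylvester_commutant inj_ca kC qE ua vc ycomm.
  rewrite mul1r addrAC subr_eq0 => /eqP qy.
  by rewrite mulr0 addr0 addrC.
- exists 0; split=> [|u v y _ _ _]; first by rewrite !(mulr0, mul0r) addr0.
  by rewrite !(mulr0, mul0r) mulr1 mul1r addr0 add0r.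
Qed.

End SpectralIdempotents.

(** * Arithmetic and quasipolarity of T_3(R) *)

Section T3.
Variable R : pzRingType.
Implicit Types (A B : T3 R) (i j : 'I_3).

Lemma T3_off A i j : i != j -> i != 1 -> (A : 'M_3) i j = 0.
Proof. by case: A => A /= /T3_predP; apply. Qed.

Lemma T3_eq A B :
    (forall i, (A : 'M_3) i i = (B : 'M_3) i i) ->
    (forall j, j != 1 -> (A : 'M_3) 1 j = (B : 'M_3) 1 j) ->
  A = B.
Proof.
move=> AB AB1; apply/val_inj/matrixP => i j /=.
have [-> //|ij] := eqVneq i j.
have [i1|i1] := eqVneq i 1; last by rewrite !T3_off.
by move: ij; rewrite i1 eq_sym; apply: AB1.
Qed.

Lemma T3_mul_diag A B i : (A * B : T3 R) i i = A i i * B i i.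
Proof.
rewrite [LHS]mxE (bigD1 i) //= big1 ?addr0 // => k ki.
have [i1|i1] := eqVneq i 1; last by rewrite T3_off ?mul0r // eq_sym.
by rewrite [X in _ * X]T3_off ?mulr0 // -i1.
Qed.

(** Each [j != 1] thus gives a copy of 2 x 2 triangular multiplication, which lets the two
    off-diagonal entries be treated separately. *)
Lemma T3_mul_row1 A B j :
  j != 1 -> (A * B : T3 R) 1 j = A 1 1 * B 1 j + A 1 j * B j j.
Proof.
move=> j1; rewrite [LHS]mxE (bigD1 1) //= (bigD1 j) //= big1 ?addr0 //.
by move=> k /andP[k1 kj]; rewrite [X in _ * X]T3_off ?mulr0.
Qed.

Lemma T3_of_subproof (d q : 'I_3 -> R) :
  \matrix_(i, j) (if i == j then d i else if i == 1 then q j else 0)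
    \in @T3_pred R.
Proof. by apply/T3_predP => i j /negPf ij /negPf i1; rewrite mxE ij i1. Qed.

Definition T3_of d q : T3 R := MkT3 (T3_of_subproof d q).

Lemma T3_of_diag d q i : T3_of d q i i = d i.
Proof. by rewrite mxE eqxx. Qed.

Lemma T3_of_row1 d q j : j != 1 -> T3_of d q 1 j = q j.
Proof. by rewrite eq_sym => /negPf j1; rewrite mxE j1 eqxx. Qed.

Lemma T3_unit A : (forall i, is_unit ((A : 'M_3) i i)) -> is_unit A.
Proof.
move=> /choice[u uA].
have Au i : A i i * u i = 1 by case: (uA i).
have {}uA i : u i * A i i = 1 by case: (uA i).
(* This is the inverse of [[s, x], [0, t]], with off-diagonal entry [- s^-1 x t^-1], for each
   [j != 1]. *)
exists (T3_of u (fun j => - (u 1 * A 1 j * u j))).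
split; apply: T3_eq => [i|j j1].
- by rewrite T3_mul_diag T3_of_diag Au mxE eqxx.
- rewrite T3_mul_row1 // T3_of_diag T3_of_row1 // mulrN !mulrA Au mul1r addNr.
  by rewrite mxE eq_sym (negPf j1).
- by rewrite T3_mul_diag T3_of_diag uA mxE eqxx.
- rewrite T3_mul_row1 // T3_of_diag T3_of_row1 // mulNr -!mulrA uA mulr1 subrr.
  by rewrite mxE eq_sym (negPf j1).
Qed.

Lemma T3_quasipolar :
  local_ring R -> uniquely_bleached R -> quasipolar (T3 R : pzRingType).
Proof.
move=> Rlocal Rbl A.
have /choice[e eA] := fun i => local_spectral_exists Rlocal ((A : 'M_3) i i).
have /choice[q qP] := fun j =>
  sylvester_spectral Rbl (A 1 j) (eA 1) (eA j).
have ee i : e i * e i = e i.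
  by case: (eA i) => -[-> _]; rewrite ?mulr0 ?mulr1.
exists (T3_of e q); split.
- apply: T3_eq => [i|j j1]; first by rewrite T3_mul_diag !T3_of_diag ee.
  by rewrite T3_mul_row1 // !T3_of_diag !T3_of_row1 //; case: (qP j).
- move=> Y YA.
  have Yd i : Y i i * A i i = A i i * Y i i by rewrite -!T3_mul_diag YA.
  apply: T3_eq => [i|j j1].
    rewrite !T3_mul_diag T3_of_diag.
    by case: (eA i) => -[-> _]; rewrite ?(mulr0, mul0r, mulr1, mul1r).
  rewrite !T3_mul_row1 // !T3_of_diag !T3_of_row1 //.
  (* The remaining premise is entry [(1, j)] of [Y A = A Y]. *)
  have [_ + ] := qP j; apply=> //.
  by rewrite addrC -T3_mul_row1 // YA T3_mul_row1 // addrC.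
- apply: T3_unit => i; rewrite mxE T3_of_diag.
  case: (eA i) => -[-> Ai]; first by rewrite addr0.
  by rewrite addrC; apply: is_unit_1addJ.
- move=> X _; apply: T3_unit => i.
  (* The diagonal entries are 1 where [e i = 0], and [1 + a x] with [a] in J(R) where [e i = 1]. *)
  rewrite mxE !T3_mul_diag T3_of_diag [1%:M i i]mxE eqxx.
  case: (eA i) => -[-> Ai]; last by rewrite mulr1; apply: is_unit_1addJM.
  by rewrite mulr0 mul0r addr0; apply: is_unit1.
Qed.

End T3.

(* [f] and [g] exhibit [T] as the corner ring at the idempotent [e = g 1]; the
   assumption says that moreover [s e = e s e] for all [s]. *)
Lemma quasipolar_corner (S T : pzRingType) (f : {rmorphism S -> T})
    (g : T -> S) :
    {morph g : x y / x * y} -> cancel g f -> (forall s, s * g 1 = g (f s)) ->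
  quasipolar S -> quasipolar T.
Proof.
move=> gM gK gf qS a; have [p [pp pC ap_unit ap_qnil]] := qS (g a).
have fpC y : comm a y -> f p * y = y * f p.
  move=> ay; have := congr1 f (pC (g y) _); rewrite !rmorphM gK; apply.
  by rewrite /comm -!gM ay.
(* The product lies in the corner: [p] commutes with [g a = g 1 * g a], and [p * g 1 = g (f p)]. *)
have gap : g a * p = g (a * f p).
  rewrite -(pC (g a) erefl) -{1}[a]mul1r gM mulrA gf -gM.
  by rewrite (fpC a erefl).
exists (f p); split.
- by rewrite -rmorphM pp.
- exact: fpC.
- by have := is_unit_rmorph f ap_unit; rewrite rmorphD gK.
- move=> x xap; have := ap_qnil (g x); rewrite gap /comm -!gM xap.
  by move=> /(_ erefl) /(is_unit_rmorph f); rewrite rmorphD rmorph1 gK.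
Qed.

(** * T_2(R) as a corner of T_3(R), and its diagonal elements *)

Section T2.
Variable R : pzRingType.

Lemma T2_of_T3_subproof (A : T3 R) :
  drsubmx (A : 'M[R]_(1 + 2)) \in @T2_pred R.
Proof.
apply/T2_predP => i j ji; rewrite !mxE T3_off //.
  by rewrite -val_eqE /= eqn_add2l gtn_eqF.
by rewrite -val_eqE /=; case: i ji => -[].
Qed.

Definition T2_of_T3 (A : T3 R) : T2 R := MkT2 (T2_of_T3_subproof A).

(** The vanishing upper right block is what makes the passage to the lower right block
    multiplicative. *)
Lemma T3_block (A : T3 R) :
  (A : 'M_(1 + 2)) =
  block_mx (ulsubmx (A : 'M_(1 + 2))) 0 (dlsubmx (A : 'M_(1 + 2))) (T2_of_T3 A).
Proof.
apply: etrans (esym (@submxK R 1 2 1 2 A)) _; congr block_mx.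
by apply/matrixP => i j; rewrite !mxE T3_off // ord1.
Qed.

Lemma T2_of_T3_zmod_morphism : zmod_morphism T2_of_T3.
Proof. by move=> A B; apply/val_inj/matrixP => i j; rewrite !mxE. Qed.

Lemma T2_of_T3_monoid_morphism : monoid_morphism T2_of_T3.
Proof.
split; first by apply/val_inj/matrixP => i j; rewrite !mxE.
move=> A B; apply/val_inj.
transitivity (drsubmx ((A : 'M_(1 + 2)) *m (B : 'M_(1 + 2)))) => //.
by rewrite (T3_block A) (T3_block B) mulmx_block block_mxKdr mulmx0 add0r.
Qed.

HB.instance Definition _ :=
  GRing.isZmodMorphism.Build (T3 R) (T2 R) T2_of_T3 T2_of_T3_zmod_morphism.
HB.instance Definition _ :=
  GRing.isMonoidMorphism.Build (T3 R) (T2 R) T2_of_T3 T2_of_T3_monoid_morphism.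

Lemma T3_of_T2_subproof (A : T2 R) :
  (block_mx 0 0 0 (A : 'M_2) : 'M[R]_(1 + 2)) \in @T3_pred R.
Proof.
apply/T3_predP => i j.
case: (@split_ordP 1 2 i) => i' ->; case: (@split_ordP 1 2 j) => j' -> ij i1.
- by apply: etrans (block_mxEul _ _ _ _ _ _) _; rewrite mxE.
- by apply: etrans (block_mxEur _ _ _ _ _ _) _; rewrite mxE.
- by apply: etrans (block_mxEdl _ _ _ _ _ _) _; rewrite mxE.
apply: etrans (block_mxEdr _ _ _ _ _ _) _; case: A => A /= /T2_predP; apply.
by case: i' j' ij i1 => [[|[]] // ?] [[|[]] // ?].
Qed.

Definition T3_of_T2 (A : T2 R) : T3 R := MkT3 (T3_of_T2_subproof A).

(** This embedding is not unital: it sends 1 to the idempotent diag(0, 1, 1) that cuts out the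
    corner. *)
Lemma T3_of_T2M : {morph T3_of_T2 : A B / A * B}.
Proof.
move=> A B; apply/val_inj; symmetry.
transitivity (block_mx (0 : 'M_1) 0 0 (A : 'M_2) *m
              block_mx (0 : 'M_1) 0 0 (B : 'M_2)).
  by [].
by rewrite mulmx_block !mulmx0 !mul0mx !add0r.
Qed.

Lemma T3_of_T2K : cancel T3_of_T2 T2_of_T3.
Proof. by move=> A; apply/val_inj; rewrite /= block_mxKdr. Qed.

Lemma T3_mul_T2_1 (A : T3 R) : A * T3_of_T2 1 = T3_of_T2 (T2_of_T3 A).
Proof.
apply/val_inj.
transitivity ((A : 'M_(1 + 2)) *m block_mx (0 : 'M_1) 0 0 1%:M) => //.
by rewrite (T3_block A) mulmx_block !mulmx0 !mulmx1 !add0r.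
Qed.

Lemma T2_quasipolar : quasipolar (T3 R : pzRingType) ->
  quasipolar (T2 R : pzRingType).
Proof. exact: (quasipolar_corner T3_of_T2M T3_of_T2K T3_mul_T2_1). Qed.

Lemma T2_of_subproof (a x d : R) :
  \matrix_(i, j) (if i == j then if i == 0 then a else d
                  else if i == 0 then x else 0) \in @T2_pred R.
Proof.
apply/T2_predP => i j ji; rewrite mxE -!val_eqE /= gtn_eqF //.
by rewrite gtn_eqF // (leq_trans _ ji).
Qed.

Definition T2_of a x d : T2 R := MkT2 (T2_of_subproof a x d).

Lemma T2_ofE (A : T2 R) : A = T2_of (A 0 0) (A 0 1) (A 1 1).
Proof.
apply/val_inj/matrixP => i j; rewrite mxE.
case: i => [[|[]] // hi]; case: j => [[|[]] // hj] /=;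
  try by congr (val A _ _); apply/val_inj.
by case: A => A /= /T2_predP; apply.
Qed.

Lemma T2_of_inj a x d a' x' d' :
  T2_of a x d = T2_of a' x' d' -> [/\ a = a', x = x' & d = d'].
Proof.
move=> /(congr1 val) /matrixP E.
by move: (E 0 0) (E 0 1) (E 1 1); rewrite !mxE.
Qed.

Lemma T2_ofD a x d a' x' d' :
  T2_of a x d + T2_of a' x' d' = T2_of (a + a') (x + x') (d + d').
Proof.
by apply/val_inj/matrixP => i j; rewrite !mxE; do !case: ifP; rewrite ?addr0.
Qed.

Lemma T2_ofM a x d a' x' d' :
  T2_of a x d * T2_of a' x' d' = T2_of (a * a') (a * x' + x * d') (d * d').
Proof.
rewrite [LHS]T2_ofE; congr T2_of; rewrite /= mxE !big_ord_recl big_ord0 !mxE /=;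
  by rewrite ?(mulr0, mul0r, addr0, add0r).
Qed.

Lemma T2_of1 : 1 = T2_of 1 0 1.
Proof. by rewrite [LHS]T2_ofE; congr T2_of; rewrite mxE. Qed.

Lemma T2_of_unit a x d : is_unit (T2_of a x d) -> is_unit a /\ is_unit d.
Proof.
case=> B; rewrite [B]T2_ofE !T2_ofM !T2_of1 => -[].
move=> /T2_of_inj[aB _ dB] /T2_of_inj[Ba _ Bd].
by split; [exists (B 0 0)|exists (B 1 1)].
Qed.

Lemma T2_diag_spectral (a d : R) : quasipolar_elt (T2_of a 0 d) ->
  exists p q, [/\ comm2 (T2_of a 0 d) (T2_of p 0 q),
    [/\ p * p = p, is_unit (a + p) & qnil (a * p)] &
    [/\ q * q = q, is_unit (d + q) & qnil (d * q)]].
Proof.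
have zE := (mulr0, mul0r, addr0, add0r).
case=> P; rewrite [P]T2_ofE.
move: (P 0 0) (P 0 1) (P 1 1) => p x q [PP Pcomm2].
have x0 : x = 0.
  (* The matrix unit E_00 commutes with diag(a, d), hence with [P], which is therefore diagonal. *)
  have := Pcomm2 (T2_of 1 0 0); rewrite /comm !T2_ofM !zE !mulr1 !mul1r.
  by case/(_ erefl)/T2_of_inj.
rewrite {}x0 in PP Pcomm2 *.
rewrite T2_ofM T2_ofD !zE => AP_unit AP_qnil.
exists p, q; split=> //; move: PP; rewrite T2_ofM => /T2_of_inj[pp _ qq].
  split=> // [|y yap]; first by case/T2_of_unit: AP_unit.
  (* Quasinilpotence is tested on diag(y, 0) here and on diag(0, y) for the other entry. *)
  have := AP_qnil (T2_of y 0 0); rewrite /comm !T2_ofM !zE T2_of1 T2_ofD yap.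
  by case/(_ erefl)/T2_of_unit.
split=> // [|y yap]; first by case/T2_of_unit: AP_unit.
have := AP_qnil (T2_of 0 0 y); rewrite /comm !T2_ofM !zE T2_of1 T2_ofD yap.
by case/(_ erefl)/T2_of_unit.
Qed.

(** The condition on [e] and [e'] holds when they are 0 and 1 in either order, so both maps of
    unique bleachedness are covered. *)
Lemma T2_quasipolar_inj (Rlocal : local_ring R) (a d e e' : R) :
    quasipolar (T2 R : pzRingType) -> local_spectral a e ->
    local_spectral d e' -> (forall x, e * x = x * e' -> x = 0) ->
  injective (lr_sub a d).
Proof.
move=> qT2 ae de' ee' x y /eqP.
rewrite -subr_eq0 -raddfB /= => /eqP xy; apply/subr0_eq.
have [p [q [pqC [pp ap_unit ap_qnil] [qq dq_unit dq_qnil]]]] :=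
  T2_diag_spectral (qT2 (T2_of a 0 d)).
have pe := local_spectral_uniq Rlocal ae pp ap_unit ap_qnil.
have qe' := local_spectral_uniq Rlocal de' qq dq_unit dq_qnil.
(* From [a z = z d] with [z = x - y], the matrix [z E_01] commutes with diag(a, d), hence with
   diag(e, e'), so [e z = z e']. *)
apply: ee'; have := pqC (T2_of 0 (x - y) 0); rewrite /comm !T2_ofM.
rewrite !(mulr0, mul0r, addr0, add0r) (subr0_eq xy).
by case/(_ erefl)/T2_of_inj; rewrite pe qe'.
Qed.

End T2.

(** * From T_2(R) back to [R], and the cycle of implications *)

Lemma surj_inj_bij (R : pzRingType) (f : R -> R) :
  surjective f -> injective f -> bijective f.
Proof.
move=> /choice[g fK] f_inj; exists g => // x.
by apply: f_inj; rewrite fK.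
Qed.

Lemma T2_quasipolar_uniquely_bleached (R : pzRingType) :
    local_ring R -> bleached R -> quasipolar (T2 R : pzRingType) ->
  uniquely_bleached R.
Proof.
move=> Rlocal Rbl qT2 a b Ja Ub; have [surj_ba surj_ab] := Rbl a b Ja Ub.
have a1 : local_spectral a 1 by right.
have b0 : local_spectral b 0 by left.
split; apply: surj_inj_bij => //.
  by apply: (T2_quasipolar_inj Rlocal qT2 b0 a1) => x; rewrite mul0r mulr1.
by apply: (T2_quasipolar_inj Rlocal qT2 a1 b0) => x; rewrite mulr0 mul1r.
Qed.

Theorem theorem3p1 (R : pzRingType) (Rlocal : local_ring R)
    (Rbleached : bleached R) :
  [<-> uniquely_bleached R;
       quasipolar (T3 R : pzRingType);
       quasipolar (T2 R : pzRingType)].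
Proof.
tfae.
- exact: T3_quasipolar.
- exact: T2_quasipolar.
- exact: T2_quasipolar_uniquely_bleached.
Qed.
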